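(* Let $\phi=\{\phi_j\}$ be a sequence having strong limit values $\phi^*$. Then: (1) any two functions that are strong limit values of $\phi$ coincide $\mu$-a.e.; for every real constant $c$ the sequence $c\phi=\{c\phi_j\}$ has strong limit values $c\phi^*$; and for every $p>0$ the sequence $|\phi|^p=\{|\phi_j|^p\}$ has strong limit values $|\phi^*|^p$. (2) If moreover $\mu_j\to\mu$ weak-* regularly and $\psi=\{\psi_j\}\in\mathcal A(M)$ has strong limit values $\psi^*$, then $\phi+\psi=\{\phi_j+\psi_j\}$ has strong limit values $\phi^*+\psi^*$ and $\phi\psi=\{\phi_j\psi_j\}$ has strong limit values $\phi^*\psi^*$.
   Context: $K$ is a compact metric space and $M=\{\mu_j\}_{j\ge1}$ is a sequence of finite positive regular Borel measures on $K$ converging weak-* in $C(K)^*$ (i.e. $\int h\,d\mu_j\to\int h\,d\mu$ for all $h\in C(K)$) to a finite positive Borel measure $\mu$. Write $K_j=\operatorname{supp}\mu_j$ and $K_0=\operatorname{supp}\mu$. A ''sequence'' $\phi=\{\phi_j\}$ means a sequence of real-valued Borel functions $\phi_j$ on $K_j$. A sequence $\phi$ has weak limit values $\phi_*$ if $\phi_*$ is a $\mu$-integrable function on $K_0$ and $\int_{K_j}h\phi_j\,d\mu_j\to\int_{K_0}h\phi_*\,d\mu$ for every $h\in C(K)$; $\mathcal A(M)$ is the set of sequences having weak limit values. A sequence $\phi$ has strong limit values $\phi^*$ (a real-valued $\mu$-measurable function on $K_0$) if for all real $a<b$ and all $\varepsilon,\delta>0$ there are $j_0$ and an open set $O\subset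 K$ containing $G(a,b)=\{x\in K_0:a\le\phi^*(x)<b\}$ such that $\mu_j(\{x\in K_j:\phi_j(x)<a-\varepsilon\}\cap O)+\mu_j(\{x\in K_j:\phi_j(x)>b+\varepsilon\}\cap O)<\delta$ for all $j\ge j_0$. The convergence $\mu_j\to\mu$ is called regular if for every $\mu$-measurable $A\subset K_0$ and $\varepsilon>0$ there are an open $O\supset A$ and $j_0$ with $\mu_j(O)<\mu(A)+\varepsilon$ for $j\ge j_0$. *)

(* Defs.v *)
From HB Require Import structures.
From mathcomp Require Import all_boot all_order all_algebra.
From mathcomp Require Import all_classical all_reals all_analysis.
Set Implicit Arguments. Unset Strict Implicit. Unset Printing Implicit Defensive.
Import Order.TTheory GRing.Theory Num.Theory.
Import numFieldNormedType.Exports.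
Local Open Scope classical_set_scope.
Local Open Scope ring_scope.

Definition borel (K : ptopologicalType) := g_sigma_algebraType (@open K).

Section defs.
Context {R : realType} {K : ptopologicalType}.
Local Notation BK := (borel K).

Definition msupp (m : {measure set BK -> \bar R}) : set K :=
  [set x | forall O : set K, open O -> O x -> (0 < m O)%E].

Definition mu_measurable_set (m : {measure set BK -> \bar R}) (A : set K) :=
  exists B C : set BK, [/\ measurable B, measurable C, B `<=` A, A `<=` C
                        & m (C `\` B) = 0%E].

Definition mu_measurable_fun (m : {measure set BK -> \bar R}) (D : set K)
    (f : K -> R) :=
  forall t : R, mu_measurable_set m (D `&` [set x | f x < t]).

Definition weak_star_cvg (mu_ : nat -> {finite_measure set BK -> \bar R})
    (mu : {finite_measure set BK -> \bar R}) :=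
  forall h : K -> R, continuous h ->
    (fun j => (\int[mu_ j]_(x in [set: BK]) (h x)%:E)%E) @ \oo -->
      (\int[mu]_(x in [set: BK]) (h x)%:E)%E.

(* regular convergence; for an m-measurable A with Borel kernel B and hull C
   (m (C \ B) = 0), the measure mu(A) is mu(B) *)
Definition regular_cvg (mu_ : nat -> {finite_measure set BK -> \bar R})
    (mu : {finite_measure set BK -> \bar R}) :=
  forall (A : set K) (B C : set BK),
    measurable B -> measurable C -> B `<=` A -> A `<=` C ->
    mu (C `\` B) = 0%E -> A `<=` msupp mu ->
    forall eps : R, 0 < eps ->
      exists O : set K, [/\ open O, A `<=` O &
        exists j0 : nat, forall j, (j0 <= j)%N -> (mu_ j O < mu B + eps%:E)%E].

Definition weak_limit_values (mu_ : nat -> {finite_measure set BK -> \bar R})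
    (mu : {finite_measure set BK -> \bar R}) (phi : nat -> K -> R)
    (phis : K -> R) :=
  mu.-integrable (msupp mu) (fun x => (phis x)%:E) /\
  forall h : K -> R, continuous h ->
    (fun j => (\int[mu_ j]_(x in msupp (mu_ j)) (h x * phi j x)%:E)%E) @ \oo -->
      (\int[mu]_(x in msupp mu) (h x * phis x)%:E)%E.

Definition in_AM (mu_ : nat -> {finite_measure set BK -> \bar R})
    (mu : {finite_measure set BK -> \bar R}) (phi : nat -> K -> R) :=
  exists phis : K -> R, weak_limit_values mu_ mu phi phis.

Definition strong_limit_values (mu_ : nat -> {finite_measure set BK -> \bar R})
    (mu : {finite_measure set BK -> \bar R}) (phi : nat -> K -> R)
    (phis : K -> R) :=
  mu_measurable_fun mu (msupp mu) phis /\
  forall a b : R, a < b -> forall eps delta : R, 0 < eps -> 0 < delta ->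
    exists j0 : nat, exists O : set K,
      [/\ open O,
          [set x | msupp mu x /\ a <= phis x < b] `<=` O &
          forall j, (j0 <= j)%N ->
            (mu_ j ([set x | msupp (mu_ j) x /\ (phi j x < a - eps)%R] `&` O)
             + mu_ j ([set x | msupp (mu_ j) x /\ (phi j x > b + eps)%R] `&` O)
             < delta%:E)%E].

End defs.

(* Main.v *)
(* Strong limit values pass through a continuous F : R^2 -> R. Near a point
   (s, t), phi_j and psi_j stay close to s and t on a neighborhood of the set
   where their limits phis and psis are close to s and t, up to small
   mu_j-measure, so F is controlled there; compactness then covers any bounded
   square. What remains is the set where phis or psis is large. For c phi
   (c != 0) and |phi|^p it does not meet {a <= F < b}; under regular convergence
   it has small mu-measure, hence an open neighborhood of small mu_j-measure.
   For uniqueness, if f and g are strong limit values, the cell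
   {a <= f < b} /\ {c <= g < d} with b < c lies in an open set of small
   mu_j-measure, hence of small mu-measure by weak-* convergence. *)
Require Import Defs.
From HB Require Import structures.
From mathcomp Require Import all_boot all_order all_algebra.
From mathcomp Require Import all_classical all_reals all_analysis.
From mathcomp Require Import measurable_realfun ring lra.
Import Order.TTheory GRing.Theory Num.Theory.
Import numFieldNormedType.Exports.
Local Open Scope classical_set_scope.
Local Open Scope ring_scope.

(** Induction on compact sets, for properties inherited by subsets and finite unions. If [P A]
    failed, the filter of complements would cluster at a point of [A]; a neighborhood satisfying [P]
    would then have to meet its own complement. *)
Lemma compact_local (T : topologicalType) (P : set T -> Prop) (A : set T) :
  P set0 ->
  (forall B C, B `<=` C -> P C -> P B) ->
  (forall B C, P B -> P C -> P (B `|` C)) ->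
  (forall x, A x -> exists2 U, nbhs x U & P U) ->
  compact A -> P A.
Proof.
move=> P0 Psub PU Ploc cA; apply: contrapT => nPA.
(* the complements in [A] of the sets in [P] form a proper filter *)
pose F : set_system T := [set B | P (A `\` B)].
have FF : ProperFilter F.
  split; first by rewrite /F /= setD0.
  split; first by rewrite /F /= setDT.
    by move=> B C FB FC; rewrite /F /= setDIr; exact: PU.
  by move=> B C BC; apply: Psub; apply: setDS.
have FA : F A by rewrite /F /= setDv.
have [x [Ax clx]] := cA F FF FA.
have [U Ux PUx] := Ploc x Ax.
have FcU : F (~` U) by apply: Psub PUx => y [_ /contrapT].
by have [y []] := clx _ _ FcU Ux.
Qed.

(** * Borel sets and the support of a measure *)

Section borel_space.
Context {R : realType} {K : ptopologicalType}.
Local Notation BK := (borel K).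
Implicit Types m : {measure set BK -> \bar R}.

Lemma open_borel (U : set K) : open U -> measurable (U : set BK).
Proof. by move=> oU; exact: sub_sigma_algebra. Qed.

Lemma closed_borel (C : set K) : closed C -> measurable (C : set BK).
Proof.
by move=> cC; rewrite -[X in measurable X]setCK; apply: measurableC;
  apply: open_borel; exact: closed_openC.
Qed.

Lemma continuous_borel (h : K -> R) : continuous h ->
  measurable_fun [set: BK] h.
Proof.
move=> ch; apply: (measurability _ (RGenInftyO.measurableE R)).
move=> _ [_ [a ->] <-]; rewrite setTI set_itvNyo; apply: open_borel.
by move/continuousP : ch; apply; exact: open_lt.
Qed.

Lemma closed_msupp m : closed (msupp m).
Proof.
rewrite -[msupp m]setCK; apply: open_closedC; rewrite openE => x /=.
move=> /existsNP[U /not_implyP[oU /not_implyP[Ux mU]]].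
apply: filterS (open_nbhs_nbhs (conj oU Ux)) => y Uy /(_ U oU Uy); exact: mU.
Qed.

Lemma measurable_msupp m : measurable (msupp m : set BK).
Proof. by apply: closed_borel; exact: closed_msupp. Qed.

End borel_space.

(** * Exhaustion of open sets by closed sets; nullity off the support *)

Section inner_core.
Context {R : realType} {K : pseudoPMetricType R}.
Local Notation BK := (borel K).
Implicit Types m : {measure set BK -> \bar R}.

(* Interiors are taken because the balls of a [pseudoMetricType] need not be
   open. *)
Definition inner_core (U : set K) (n : nat) : set K :=
  ~` \bigcup_(y in ~` U) (ball y n.+1%:R^-1)°.

Lemma closed_inner_core U n : closed (inner_core U n).
Proof.
by apply: open_closedC; apply: bigcup_open => y _; exact: open_interior.
Qed.

Lemma inner_core_homo U : nondecreasing_seq (inner_core U).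
Proof.
move=> n k nk; apply/subsetPset; apply: subsetC => x [y Uy yx].
exists y => //; apply: filterS yx; apply: le_ball.
by rewrite lef_pV2 ?posrE// ler_nat.
Qed.

(** Together with closedness and monotonicity, this exhausts an open set from inside by sets that
    are compact when [K] is. It serves both for null sets and for continuity from below. *)
Lemma bigcup_inner_core (U : set K) : open U -> \bigcup_n inner_core U n = U.
Proof.
move=> oU; apply/seteqP; split=> x.
  move=> [n _ cx]; apply: contrapT => Ux; apply: cx; exists x => //.
  exact: nbhsx_ballx.
move=> Ux; have [e e0 eU] : exists2 e : R, 0 < e & ball x e `<=` U.
  by move: oU; rewrite openE => /(_ x Ux)/nbhs_ballP[e /= e0 eU]; exists e.
have [n ne] : exists n : nat, n.+1%:R^-1 < e.
  exists (Num.truncn e^-1); rewrite invf_plt ?posrE//.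
  exact: truncnS_gt.
exists n => // -[y Uy /interior_subset yx]; apply: Uy; apply: eU.
by apply: ball_sym; apply: le_ball yx; exact: ltW.
Qed.

(** Off the support every point has a null open neighborhood. Each inner core of the complement is
    compact, hence null by [compact_local], and countably many cores exhaust the complement. *)
Lemma negligible_msuppC m : compact [set: K] -> m.-negligible (~` msupp m).
Proof.
move=> cK.
have oS : open (~` msupp m) by rewrite openC; exact: closed_msupp.
rewrite -(bigcup_inner_core _ oS).
apply: negligible_bigcup => n; set F := inner_core _ n.
have FU : F `<=` ~` msupp m.
  by rewrite -[X in _ `<=` X](bigcup_inner_core _ oS); exact: bigcup_sup.
apply: (@compact_local K (fun A : set K => m.-negligible (A : set BK))).
- exact: negligible_set0.
- by move=> B C BC; exact: negligibleS.
- by move=> B C; exact: negligibleU.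
- move=> x /FU /existsNP[U /not_implyP[oU /not_implyP[Ux /negP]]].
  rewrite lt0e measure_ge0 andbT negbK => /eqP mU.
  by exists U; [exact: open_nbhs_nbhs|exists U; split=> //; exact: open_borel].
- by apply: subclosed_compact cK _ => //; exact: closed_inner_core.
Qed.

(** The functions [phi j] are controlled only on the support of [mu_ j]; this allows the mass of a
    whole open set to be estimated there. *)
Lemma measureI_msupp m (A : set BK) : compact [set: K] -> measurable A ->
  m (msupp m `&` A) = m A.
Proof.
move=> cK mA; have mS := measurable_msupp m.
rewrite -[in RHS](setIT A) -(setUv (msupp m)) setIUr measureU0 1?setIC//.
- exact: measurableI.
- by apply: measurableI => //; exact: measurableC.
have /negligibleP := negligible_msuppC m cK.
move=> /(_ (measurableC mS)) m0.
apply: (subset_measure0 _ _ _ m0) => //.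
  by apply: measurableI => //; exact: measurableC.
exact: measurableC.
Qed.

End inner_core.

(** * Sublevel sets and null sets in a measurable space *)

Section null_sets.
Context {d : measure_display} {T : measurableType d} {R : realType}.
Implicit Types (m : {measure set T -> \bar R}) (D : set T) (f : T -> R).

Lemma measurable_sublevel D f (t : R) : measurable D -> measurable_fun D f ->
  measurable [set x | D x /\ f x < t].
Proof.
move=> mD mf; have := mf mD _ (measurable_itv `]-oo, t[).
by rewrite set_itvNyo.
Qed.

Lemma measurable_superlevel D f (t : R) : measurable D -> measurable_fun D f ->
  measurable [set x | D x /\ t < f x].
Proof.
move=> mD mf; have := mf mD _ (measurable_itv `]t, +oo[).
by rewrite set_itvoy.
Qed.

Lemma negligible_small_cover m (A : set T) :
  (forall e : R, 0 < e ->
     exists B, [/\ measurable B, A `<=` B & (m B <= e%:E)%E]) ->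
  m.-negligible A.
Proof.
move=> small; have e0 n : 0 < n.+1%:R^-1 :> R by rewrite invr_gt0.
pose B n := sval (cid (small _ (e0 n))).
have BP n : [/\ measurable (B n), A `<=` B n & (m (B n) <= n.+1%:R^-1%:E)%E].
  by rewrite /B; case: cid.
have mI : measurable (\bigcap_n B n).
  by apply: bigcapT_measurable => n; have [] := BP n.
exists (\bigcap_n B n); split => //.
- apply/eqP; rewrite eq_le measure_ge0 andbT; apply/lee_addgt0Pr => e egt0.
  rewrite add0e; have [n ne] : exists n : nat, n.+1%:R^-1 < e.
    exists (Num.truncn e^-1); rewrite invf_plt ?posrE//; exact: truncnS_gt.
  have [mB _ mBe] := BP n.
  apply: (@le_trans _ _ (m (B n))).
    by apply: le_measure; rewrite ?inE//; exact: bigcap_inf.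
  by apply: (le_trans mBe); rewrite lee_fin ltW.
- by move=> x Ax n _; have [_ /(_ x Ax)] := BP n.
Qed.

End null_sets.

(** * Measurability with respect to the completed measure *)

Section mu_measurability.
Context {R : realType} {K : ptopologicalType}.
Local Notation BK := (borel K).

(** Each rational sublevel set has a Borel kernel and hull with null gap. Removing the countable
    union [N] of these gaps makes [f] Borel. In this form measurability passes through
    compositions. *)
Lemma mu_measurable_funP (m : {measure set BK -> \bar R}) (D : set K)
    (f : K -> R) : measurable (D : set BK) ->
  mu_measurable_fun m D f <->
  exists N : set BK,
    [/\ measurable N, m N = 0%E & measurable_fun ((D : set BK) `\` N) f].
Proof.
move=> mD; split; last first.
  move=> [N [mN N0 mf]] t.
  have mDN : measurable ((D : set BK) `\` N) by exact: measurableD.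
  have mE := measurable_sublevel _ _ t mDN mf.
  set E := [set x | _] in mE.
  exists E, (E `|` (D `&` N)); split=> //.
  - by apply: measurableU => //; exact: measurableI.
  - by move=> x [[]].
  - move=> x [Dx fx]; have [Nx|Nx] := pselect (N x); first by right.
    by left.
  - apply: (@subset_measure0 _ _ _ _ _ N) => //.
      by apply: measurableD => //; apply: measurableU => //; exact: measurableI.
    by move=> x [[|[]]].
move=> mf.
(* An enumeration of the rationals; indices that code no rational repeat the value 0, which is
   harmless. *)
pose q n : R := ratr (odflt 0 (unpickle n)).
have [B BP] := choice (fun n => mf (q n)).
have [C CP] := choice BP.
have mCB n : measurable (C n `\` B n) by have [mB mC _ _ _] := CP n; exact: measurableD.
pose N := \bigcup_n (C n `\` B n).
have mN : measurable N by exact: bigcupT_measurable.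
have N0 : m N = 0%E.
  apply/negligibleP => //; apply: negligible_bigcup => n.
  by apply/negligibleP => //; have [] := CP n.
exists N; split=> // mDN.
apply: (measurability _ (RGenInftyO.measurableE R)) => //.
move=> _ [_ [a ->] <-]; rewrite set_itvNyo.
(* A rational between [f x] and [a] gives the index [n]; then [x] is in the hull [C n], and being
   off [N] it is in the kernel [B n]. *)
have -> : ((D : set BK) `\` N) `&` f @^-1` [set x | x < a] =
    \bigcup_(n in [set n | q n < a]) (B n `\` N).
  apply/seteqP; split=> x /=.
    move=> [[Dx Nx] fxa]; have [r /[!in_itv]/= /andP[fr ra]] := rat_in_itvoo fxa.
    have qE : q (pickle r) = ratr r by rewrite /q pickleK.
    exists (pickle r); rewrite /= ?qE//; split=> //.
    apply: contrapT => Bx; apply: Nx; exists (pickle r) => //; split=> //.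
    by have [_ _ _ DC _] := CP (pickle r); apply: DC; rewrite qE.
  move=> [n /= qa [Bx Nx]]; have [_ _ BD _ _] := CP n.
  by have [Dx /= fx] := BD _ Bx; do !split=> //; exact: lt_trans qa.
by apply: bigcup_measurable => n _; apply: measurableD => //; have [] := CP n.
Qed.

End mu_measurability.

(** * Weak-* convergence on open sets and uniqueness of strong limit values *)

Section weak_star.
Context {R : realType} {K : pseudoPMetricType R}.
Local Notation BK := (borel K).
Variables (mu_ : nat -> {finite_measure set BK -> \bar R})
          (mu : {finite_measure set BK -> \bar R}).
Hypothesis cvg_mu : weak_star_cvg mu_ mu.

Lemma uniform_separator_inner_core (U : set K) n :
  uniform_separator (~` U) (inner_core U n).
Proof.
(* Half the radius: if [y] is that close to some [x] outside [U], a ball around [y] fits into the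
   ball of full radius at [x], so [y] is in its interior and not in the inner core. *)
have r0 : 0 < n.+1%:R^-1 / 2 :> R by rewrite divr_gt0.
apply: uniform_separatorW.
exists [set xy | ball xy.1 (n.+1%:R^-1 / 2) xy.2]; first exact: (entourage_ball _ (PosNum r0)).
rewrite -subset0 => -[x y] /= [[Ux Uy] xy]; apply: Uy; exists x => //.
apply/nbhs_ballP; exists (n.+1%:R^-1 / 2) => //= z yz.
by rewrite [n.+1%:R^-1](splitr); exact: ball_triangle xy yz.
Qed.

(** The open-set half of the portmanteau theorem. A Urysohn function [h] lies between the indicators
    of an inner core and of [U], so the core has [mu]-measure at most the limit of the integrals of
    [h], hence at most [e]; then the cores increase to [U]. *)
Lemma weak_star_open_le (U : set K) (e : R) : open U ->
  (\forall j \near \oo, (mu_ j U <= e%:E)%E) -> (mu U <= e%:E)%E.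
Proof.
move=> oU mu_le; have mU := open_borel _ oU.
have mF n := closed_borel _ (closed_inner_core U n).
have FU := bigcup_inner_core _ oU.
have mbigF : measurable (\bigcup_n (inner_core U n : set BK)) by rewrite FU.
have := nondecreasing_cvg_mu (mu := mu) mF mbigF (inner_core_homo U).
rewrite FU => cvgU; apply: (cvge_le _ cvgU); apply: nearW => n /=.
pose h : K -> R := Urysohn (~` U) (inner_core U n).
have sep := uniform_separator_inner_core U n.
have ch : continuous h by exact: Urysohn_continuous.
have h01 x : 0 <= h x <= 1.
  have : range h (h x) by exists x.
  by move=> /Urysohn_range; rewrite /= in_itv.
have hU x : ~ U x -> h x = 0.
  by move=> Ux; apply: (Urysohn_sub0 sep); exists x.
have hF x : inner_core U n x -> h x = 1.
  by move=> Fx; apply: (Urysohn_sub1 sep); exists x.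
have mh : measurable_fun [set: BK] (EFin \o h).
  by apply/measurable_EFinP; exact: continuous_borel.
have mind (A : set BK) : measurable A ->
    measurable_fun [set: BK] (EFin \o (\1_A : BK -> R)).
  by move=> mA; apply/measurable_EFinP; exact: measurable_indic.
apply: (@le_trans _ _ (\int[mu]_(x in [set: BK]) (h x)%:E)%E).
  rewrite -[X in mu X]setIT -integral_indic//.
  apply: ge0_le_integral => //=.
    exact: mind.
  move=> x _; rewrite lee_fin indicE.
  have [/set_mem/hF->//|_] := boolP (x \in inner_core U n).
  by case/andP: (h01 x).
apply: (cvge_le _ (cvg_mu h ch)); apply: filterS mu_le => j; apply: le_trans.
rewrite -[X in mu_ j X]setIT -integral_indic//.
apply: ge0_le_integral => //=.
- by move=> x _; rewrite lee_fin; case/andP: (h01 x).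
- exact: mind.
move=> x _; rewrite lee_fin indicE.
have [_|/negP Ux] := boolP (x \in U); first by case/andP: (h01 x).
by rewrite hU//; move/mem_set.
Qed.

Hypothesis cK : compact [set: K].
Variable phi : nat -> K -> R.
Hypothesis mphi : forall j, measurable_fun (msupp (mu_ j) : set BK) (phi j).

Lemma strong_limit_values_negligible_cell (f g : K -> R) (a b c d : R) :
  strong_limit_values mu_ mu phi f -> strong_limit_values mu_ mu phi g ->
  a < b -> b < c -> c < d ->
  mu.-negligible ([set x | msupp mu x /\ (a <= f x < b) /\ (c <= g x < d)]
                  : set BK).
Proof.
move=> [_ lf] [_ lg] ab bc cd; apply: negligible_small_cover => e e0.
have e20 : 0 < e / 2 by rewrite divr_gt0.
(* With a third of the gap as margin, [b + eps < c - eps], so every value of [phi j] exceeds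
   [b + eps] or falls below [c - eps]: all support points of [U1] and [U2] in common are exceptional
   for [f] or for [g]. *)
have eps0 : 0 < (c - b) / 3 by rewrite divr_gt0// subr_gt0.
have [j1 [U1 [oU1 fU1 leU1]]] := lf a b ab _ _ eps0 e20.
have [j2 [U2 [oU2 gU2 leU2]]] := lg c d cd _ _ eps0 e20.
have oU := openI oU1 oU2.
exists (U1 `&` U2); split; first exact: open_borel.
  by move=> x [Kx [fx gx]]; split; [exact: fU1|exact: gU2].
apply: weak_star_open_le => //; near=> j.
have mK := measurable_msupp (mu_ j).
have mlt t := measurable_sublevel _ _ t mK (mphi j).
have mgt t := measurable_superlevel _ _ t mK (mphi j).
have mU1 := open_borel _ oU1; have mU2 := open_borel _ oU2.
rewrite -(measureI_msupp (mu_ j))//; last exact: open_borel.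
have Hj1 : (j1 <= j)%N by near: j; exact: nbhs_infty_ge.
have Hj2 : (j2 <= j)%N by near: j; exact: nbhs_infty_ge.
rewrite (splitr e) EFinD.
set A := [set x | msupp (mu_ j) x /\ (phi j x > b + (c - b) / 3)%R].
set B := [set x | msupp (mu_ j) x /\ (phi j x < c - (c - b) / 3)%R].
have mA : measurable (A `&` U1 : set BK) by exact: measurableI (mgt _) mU1.
have mB : measurable (B `&` U2 : set BK) by exact: measurableI (mlt _) mU2.
apply: (@le_trans _ _ (mu_ j (A `&` U1 `|` B `&` U2))).
  apply: le_measure; rewrite ?inE.
  - by apply: measurableI => //; exact: open_borel.
  - exact: measurableU.
  move=> x [Kx [U1x U2x]]; have [lex|ltx] := lerP (phi j x) (b + (c - b) / 3).
    by right; split=> //; split=> //; lra.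
  by left.
apply: (le_trans (measureU2 (mu_ j) mA mB)).
apply: leeD.
  by apply: (le_trans _ (ltW (leU1 j Hj1))); rewrite leeDr.
by apply: (le_trans _ (ltW (leU2 j Hj2))); rewrite leeDl.
Unshelve. all: by end_near.
Qed.

(** Two rationals between [u x] and [v x], and an integer bounding both values, put [x] in one of
    countably many negligible cells; exchanging the two functions covers the other inequality. *)
Lemma strong_limit_values_ae_unique (f g : K -> R) :
  strong_limit_values mu_ mu phi f -> strong_limit_values mu_ mu phi g ->
  {ae mu, forall x : BK, msupp mu x -> f x = g x}.
Proof.
move=> lf lg.
pose cell (u v : K -> R) (i : nat * rat * rat) : set BK :=
  [set x | msupp mu x /\ (- i.1.1%:R <= u x < ratr i.1.2)
                     /\ (ratr i.2 <= v x < i.1.1%:R)].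
have cell0 u v i : strong_limit_values mu_ mu phi u ->
    strong_limit_values mu_ mu phi v -> - i.1.1%:R < ratr i.1.2 :> R ->
    ratr i.1.2 < ratr i.2 :> R -> ratr i.2 < i.1.1%:R :> R ->
    mu.-negligible (cell u v i).
  by move=> lu lv; exact: strong_limit_values_negligible_cell.
have half u v : strong_limit_values mu_ mu phi u ->
    strong_limit_values mu_ mu phi v ->
    mu.-negligible ([set x | msupp mu x /\ u x < v x] : set BK).
  (* The order conditions on the endpoints are part of [C n], which is empty when they fail, so that
     every [C n] is negligible. *)
  move=> lu lv; pose C n := if unpickle n is Some i then
    [set x | cell u v i x /\ [/\ - i.1.1%:R < ratr i.1.2 :> R,
      ratr i.1.2 < ratr i.2 :> R & ratr i.2 < i.1.1%:R :> R]] else set0.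
  apply: (@negligibleS _ _ _ _ (\bigcup_n C n)); last first.
    apply: negligible_bigcup => n; rewrite /C; case: unpickle => [i|]; last first.
      exact: negligible_set0.
    have [[i1 i2 i3]|ni] := pselect [/\ - i.1.1%:R < ratr i.1.2 :> R,
      ratr i.1.2 < ratr i.2 :> R & ratr i.2 < i.1.1%:R :> R].
      by apply: negligibleS (cell0 _ _ _ lu lv i1 i2 i3) => x [].
    by apply: negligibleS (negligible_set0 _) => x [].
  move=> x [Kx uv]; have [q /[!in_itv]/= /andP[uq qv]] := rat_in_itvoo uv.
  have [r /[!in_itv]/= /andP[qr rv]] := rat_in_itvoo qv.
  pose n := (Num.truncn (`|u x| + `|v x|)).+1.
  have nP : `|u x| + `|v x| < n%:R by exact: truncnS_gt.
  have /andP[u1 u2] : - n%:R < u x < n%:R.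
    by rewrite -ltr_norml; apply: le_lt_trans nP; rewrite lerDl.
  have /andP[v1 v2] : - n%:R < v x < n%:R.
    by rewrite -ltr_norml; apply: le_lt_trans nP; rewrite lerDr.
  exists (pickle (n, q, r)) => //; rewrite /C pickleK /cell /=; split.
    by split=> //; split; apply/andP; split=> //; exact: ltW.
  by split=> //; [exact: lt_trans uq|exact: lt_trans v2].
apply: negligibleS (negligibleU (half _ _ lf lg) (half _ _ lg lf)).
move=> x /not_implyP[Kx /eqP]; rewrite neq_lt => /orP[fg|gf]; by [left|right].
Qed.

End weak_star.

(** * Strong limit values under continuous functions of two variables *)

Section strong_limits.
Context {R : realType} {K : ptopologicalType}.
Local Notation BK := (borel K).
Variables (mu_ : nat -> {finite_measure set BK -> \bar R})
          (mu : {finite_measure set BK -> \bar R}).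
Let mS : measurable (msupp mu : set BK) := measurable_msupp mu.
Let mK j : measurable (msupp (mu_ j) : set BK) := measurable_msupp (mu_ j).
Let mopen (U : set K) : open U -> measurable (U : set BK) := @open_borel K U.

(** The definition is applied to the window from [s - r] to [s + r] with margin [r]: a deviation
    beyond [2 * r] from [s] leaves the window by more than the margin. *)
Lemma strong_limit_values_near phi f (s r e : R) :
  (forall j, measurable_fun (msupp (mu_ j) : set BK) (phi j)) ->
  strong_limit_values mu_ mu phi f -> 0 < r -> 0 < e ->
  exists (U : set K) (j0 : nat), [/\ open U,
    [set x | msupp mu x /\ `|s - f x| < r] `<=` U &
    forall j, (j0 <= j)%N ->
      (mu_ j ([set x | msupp (mu_ j) x /\ (2 * r < `|s - phi j x|)%R] `&` U)
        <= e%:E)%E].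
Proof.
move=> mphi [_ lf] r0 e0.
have rr : s - r < s + r by lra.
have [j0 [U [oU fU Ule]]] := lf _ _ rr _ _ r0 e0.
exists U, j0; split=> //.
  by move=> x [Kx]; rewrite ltr_norml => /andP[? ?]; apply: fU; split=> //; lra.
move=> j jj0; apply: (le_trans _ (ltW (Ule j jj0))).
have mU := mopen _ oU.
have ml := measurableI _ _ (measurable_sublevel _ _ (s - r - r) (mK j) (mphi j)) mU.
have mg := measurableI _ _ (measurable_superlevel _ _ (s + r + r) (mK j) (mphi j)) mU.
apply: (le_trans _ (measureU2 (mu_ j) ml mg)); apply: le_measure; rewrite ?inE.
- apply: measurableI => //; apply: measurable_superlevel => //.
  apply: measurableT_comp => //; exact: measurable_funB.
- exact: measurableU.
move=> x [[Kx]]; rewrite ltr_normr => /orP[?|?] Ux; [left|right];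
  by split=> //; split=> //; lra.
Qed.

(** The tail hypothesis supplies what compactness cannot, the points where [f] or [g] is large. It
    concerns only points with [a <= F < b], so that it can also be met by an empty set. *)
Lemma strong_limit_values_comp (F : R * R -> R) phi psi f g :
  continuous F ->
  (forall (D : set BK) u v, measurable_fun D u -> measurable_fun D v ->
     measurable_fun D (fun x => F (u x, v x))) ->
  (forall j, measurable_fun (msupp (mu_ j) : set BK) (phi j)) ->
  (forall j, measurable_fun (msupp (mu_ j) : set BK) (psi j)) ->
  (forall a b e : R, 0 < e -> exists (N : R) (U : set K) (j0 : nat),
     [/\ open U,
         [set x | [/\ msupp mu x, a <= F (f x, g x) < b &
                      N < `|f x| \/ N < `|g x|]] `<=` U &
         forall j, (j0 <= j)%N -> (mu_ j U <= e%:E)%E]) ->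
  strong_limit_values mu_ mu phi f -> strong_limit_values mu_ mu psi g ->
  strong_limit_values mu_ mu (fun j x => F (phi j x, psi j x))
                             (fun x => F (f x, g x)).
Proof.
move=> cF mF mphi mpsi tail lf lg; split.
  have [[/(mu_measurable_funP _ _ _ mS)[M [mM M0 mf]] _]
        [/(mu_measurable_funP _ _ _ mS)[N [mN N0 mg]] _]] := (lf, lg).
  apply/mu_measurable_funP => //; exists (M `|` N); split.
  - exact: measurableU.
  - exact: null_set_setU.
  - have mD : measurable ((msupp mu : set BK) `\` (M `|` N)).
      by apply: measurableD => //; exact: measurableU.
    apply: mF; [apply: measurable_funS mf|apply: measurable_funS mg].
    + exact: measurableD.
    + by apply: setDS; exact: subsetUl.
    + exact: measurableD.
    + by apply: setDS; exact: subsetUr.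
move=> a b ab eps delta eps0 delta0.
pose w x := (f x, g x).
pose lo j := [set x | msupp (mu_ j) x /\ (F (phi j x, psi j x) < a - eps)%R].
pose hi j := [set x | msupp (mu_ j) x /\ (F (phi j x, psi j x) > b + eps)%R].
pose bad j : set BK := lo j `|` hi j.
have mFj j := mF _ _ _ (mphi j) (mpsi j).
have mlo j : measurable (lo j : set BK) := measurable_sublevel _ _ _ (mK j) (mFj j).
have mhi j : measurable (hi j : set BK) := measurable_superlevel _ _ _ (mK j) (mFj j).
have mbad j : measurable (bad j) by exact: measurableU.
have badU j (U V : set K) : open U -> open V ->
    (mu_ j (bad j `&` (U `|` V)) <= mu_ j (bad j `&` U) + mu_ j (bad j `&` V))%E.
  move=> oU oV; rewrite setIUr; apply: measureU2; apply: measurableI => //;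
    exact: mopen.
(* The property fed to [compact_local]. Quantifying over [e] inside [P] lets a union give half of
   [e] to each piece. *)
pose P (W : set (R * R)) := forall e : R, 0 < e ->
  exists (U : set K) (j0 : nat), [/\ open U,
    [set x | [/\ msupp mu x, a <= F (w x) < b & W (w x)]] `<=` U &
    forall j, (j0 <= j)%N -> (mu_ j (bad j `&` U) <= e%:E)%E].
have P0 W : ~ (exists x, [/\ msupp mu x, a <= F (w x) < b & W (w x)]) -> P W.
  move=> nW e e0; exists set0, 0%N; split; first exact: open0.
    by move=> x Wx; case: nW; exists x.
  by move=> j _; rewrite setI0 measure0 lee_fin ltW.
have Pbox N : P (`[- N, N]%classic `*` `[- N, N]%classic).
  apply: compact_local.
  - by apply: P0 => -[x []].
  - move=> B C BC PC e e0; have [U [j0 [oU CU leU]]] := PC e e0.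
    by exists U, j0; split=> // x [Kx Fx /BC Cx]; exact: CU.
  - move=> B C PB PC e e0; have e20 : 0 < e / 2 by rewrite divr_gt0.
    have [U [j1 [oU BU leU]]] := PB _ e20; have [V [j2 [oV CV leV]]] := PC _ e20.
    exists (U `|` V), (maxn j1 j2); split; first exact: openU.
      by move=> x [Kx Fx [Bx|Cx]]; [left; exact: BU|right; exact: CV].
    move=> j; rewrite geq_max => /andP[jj1 jj2].
    apply: (le_trans (badU _ _ _ oU oV)); rewrite (splitr e) EFinD.
    by apply: leeD; [exact: leU|exact: leV].
  - move=> [s t] _; have eps20 : 0 < eps / 2 by rewrite divr_gt0.
    have /cvgrPdist_lt/(_ _ eps20)/nbhs_ballP[r /= r0 Fr] := cF (s, t).
    (* Closeness within [r / 3] for the limits becomes closeness within [2 * (r / 3)] for [phi j]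
       and [psi j], still below [r]. *)
    have r30 : 0 < r / 3 by rewrite divr_gt0.
    exists (ball (s, t) (r / 3)); first exact: nbhsx_ballx.
    (* A point [x0] shows that [F (s, t)] is within [eps / 2] of a value in [[a, b)]; another
       [eps / 2] leads to [F (phi j x, psi j x)], which is then not bad. Without such a point the
       empty set suffices. *)
    have [[x0 [_ /andP[ax0 x0b] wx0]]|] := pselect (exists x,
      [/\ msupp mu x, a <= F (w x) < b & ball (s, t) (r / 3) (w x)]); last exact: P0.
    have Fx0 : `|F (s, t) - F (w x0)| < eps / 2.
      by apply: Fr; apply: le_ball wx0; lra.
    move=> e e0; have e20 : 0 < e / 2 by rewrite divr_gt0.
    have [U [j1 [oU fU leU]]] := strong_limit_values_near _ _ s _ _ mphi lf r30 e20.
    have [V [j2 [oV gV leV]]] := strong_limit_values_near _ _ t _ _ mpsi lg r30 e20.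
    exists (U `&` V), (maxn j1 j2); split; first exact: openI.
      by move=> x [Kx _ [/= sx tx]]; split; [exact: fU|exact: gV].
    move=> j; rewrite geq_max => /andP[jj1 jj2].
    set A := [set x | msupp (mu_ j) x /\ (2 * (r / 3) < `|s - phi j x|)%R].
    set B := [set x | msupp (mu_ j) x /\ (2 * (r / 3) < `|t - psi j x|)%R].
    have mA : measurable (A `&` U : set BK).
      apply: measurableI; last exact: mopen.
      by apply: measurable_superlevel => //; apply: measurableT_comp => //;
        exact: measurable_funB.
    have mB : measurable (B `&` V : set BK).
      apply: measurableI; last exact: mopen.
      by apply: measurable_superlevel => //; apply: measurableT_comp => //;
        exact: measurable_funB.
    apply: (@le_trans _ _ (mu_ j (A `&` U `|` B `&` V))).
      apply: le_measure; rewrite ?inE.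
      + by apply: measurableI => //; apply: mopen; exact: openI.
      + exact: measurableU.
      move=> x [bx [Ux Vx]]; apply: contrapT => /not_orP[nA nB].
      have Kx : msupp (mu_ j) x by case: bx => -[].
      have sx : `|s - phi j x| <= 2 * (r / 3).
        by rewrite leNgt; apply/negP => ?; apply: nA.
      have tx : `|t - psi j x| <= 2 * (r / 3).
        by rewrite leNgt; apply/negP => ?; apply: nB.
      have : `|F (s, t) - F (phi j x, psi j x)| < eps / 2.
        by apply: Fr; split; rewrite /ball /=; lra.
      move: Fx0; rewrite !ltr_norml => /andP[? ?] /andP[? ?].
      by case: bx => -[_]; lra.
    apply: (le_trans (measureU2 (mu_ j) mA mB)); rewrite (splitr e) EFinD.
    by apply: leeD; [exact: leU|exact: leV].
  - by apply: compact_setX; exact: segment_compact.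
(* The low and the high bad set are measured separately, each over both [U] and [V]: four terms of
   [delta / 6] stay strictly below [delta]. *)
have delta30 : 0 < delta / 6 by rewrite divr_gt0.
have [N [U [j1 [oU tU leU]]]] := tail a b _ delta30.
have [V [j2 [oV bV leV]]] := Pbox N _ delta30.
exists (maxn j1 j2), (U `|` V); have oUV := openU oU oV; split=> //.
  move=> x [Kx Fx].
  have [?|fN] := ltP N `|f x|; first by left; apply: tU; split=> //; left.
  have [?|gN] := ltP N `|g x|; first by left; apply: tU; split=> //; right.
  by right; apply: bV; split=> //; rewrite /w; split; rewrite /= in_itv/= -ler_norml.
move=> j; rewrite geq_max => /andP[jj1 jj2].
have small (A : set BK) : measurable A -> A `<=` bad j ->
    (mu_ j (A `&` (U `|` V)) <= (delta / 3)%:E)%E.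
  move=> mA Abad; apply: (@le_trans _ _ (mu_ j (bad j `&` (U `|` V)))).
    apply: le_measure; rewrite ?inE; last exact: setSI.
    - by apply: measurableI => //; exact: mopen.
    - by apply: measurableI => //; exact: mopen.
  apply: (le_trans (badU _ _ _ oU oV)).
  have -> : delta / 3 = delta / 6 + delta / 6 by field.
  rewrite EFinD; apply: leeD; last exact: leV.
  apply: (le_trans _ (leU j jj1)); apply: le_measure; rewrite ?inE.
  - by apply: measurableI => //; exact: mopen.
  - exact: mopen.
  - exact: subIsetr.
apply: (@le_lt_trans _ _ ((delta / 3)%:E + (delta / 3)%:E)%E).
  by apply: leeD; [apply: small (mlo j) _|apply: small (mhi j) _] => x; [left|right].
by rewrite -EFinD lte_fin; lra.
Qed.

End strong_limits.

(** * Multiples, powers, and composition under regular convergence *)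

Section strong_limit_operations.
Context {R : realType} {K : ptopologicalType}.
Local Notation BK := (borel K).
Variables (mu_ : nat -> {finite_measure set BK -> \bar R})
          (mu : {finite_measure set BK -> \bar R}).
Variables (phi : nat -> K -> R) (f : K -> R).
Hypothesis mphi : forall j, measurable_fun (msupp (mu_ j) : set BK) (phi j).
Hypothesis lphi : strong_limit_values mu_ mu phi f.

(** Since [G] takes values in [[a, b)] only on a bounded set, the tail is empty for large [N]. *)
Lemma strong_limit_values_comp1 (G : R -> R) : continuous G ->
  measurable_fun [set: R] G ->
  (forall a b, exists N, forall s, a <= G s < b -> `|s| <= N) ->
  strong_limit_values mu_ mu (fun j x => G (phi j x)) (fun x => G (f x)).
Proof.
move=> cG mG bG.
apply: (strong_limit_values_comp mu_ mu (fun p => G p.1) phi phi f f) => //.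
- by move=> p; apply: continuous_comp; [exact: cvg_fst|exact: cG].
- by move=> D u v mu' _; exact: measurableT_comp.
- move=> a b e e0; have [N GN] := bG a b.
  exists N, set0, 0%N; split; first exact: open0.
    by move=> x [_ /GN]; rewrite leNgt => /negP Nf [].
  by move=> j _; rewrite measure0 lee_fin ltW.
Qed.

(** The multiple by 0, whose preimages need not be bounded. Either 0 is in [[a, b)] and the bad sets
    are empty, or the set to be covered is empty. *)
Lemma strong_limit_values_cst0 :
  strong_limit_values mu_ mu (fun _ _ => 0) (fun _ => 0).
Proof.
split.
  apply/mu_measurable_funP; first exact: measurable_msupp.
  by exists set0; split => //; exact: measurable_cst.
move=> a b ab eps delta eps0 delta0; exists 0%N.
have [/andP[a0 b0]|] := boolP (a <= 0 < b); last first.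
  move=> _; exists set0; split; first exact: open0.
    by move=> x [].
  by move=> j _; rewrite !setI0 !measure0 adde0 lte_fin.
exists setT; split; [exact: openT|by []|move=> j _].
have -> : [set x | msupp (mu_ j) x /\ (0 < a - eps)%R] = set0.
  by rewrite -subset0 => x [_]; lra.
have -> : [set x | msupp (mu_ j) x /\ (0 > b + eps)%R] = set0.
  by rewrite -subset0 => x [_]; lra.
by rewrite !set0I !measure0 adde0 lte_fin.
Qed.

Lemma strong_limit_values_scale c :
  strong_limit_values mu_ mu (fun j x => c * phi j x) (fun x => c * f x).
Proof.
have [->|c0] := eqVneq c 0.
  have -> : (fun j x => 0 * phi j x) = (fun _ _ => 0).
    by apply/funext => j; apply/funext => x; rewrite mul0r.
  have -> : (fun x => 0 * f x) = (fun _ => 0).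
    by apply/funext => x; rewrite mul0r.
  exact: strong_limit_values_cst0.
apply: (strong_limit_values_comp1 ( *%R c)).
- exact: mulrl_continuous.
- exact: mulrl_measurable.
- move=> a b; exists ((`|a| + `|b|) / `|c|) => s /andP[acs csb].
  rewrite ler_pdivlMr ?normr_gt0// -normrM mulrC ler_norml.
  have := ler_norm b; have := ler_norm (- a); rewrite normrN.
  have := normr_ge0 a; have := normr_ge0 b; lra.
Qed.

Lemma continuous_norm_powR (p : R) : 0 < p ->
  continuous (fun s : R => `|s| `^ p).
Proof.
move=> p0 s; have [->|s0] := eqVneq s 0.
  apply/cvgrPdist_lt => e e0; apply/nbhs_ballP.
  (* At 0 the power need not be differentiable when [p] is small; the radius is the preimage of [e]
     under the increasing power. *)
  exists (e `^ p^-1); first exact: powR_gt0.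
  move=> t; rewrite /ball /= sub0r normrN => te.
  rewrite normr0 powR0 ?gt_eqF// sub0r normrN ger0_norm ?powR_ge0//.
  have := gt0_ltr_powR p0; move=> /(_ `|t| (e `^ p^-1)).
  rewrite !nnegrE powR_ge0 normr_ge0 => /(_ isT isT te).
  by rewrite -powRrM mulVf ?gt_eqF// powRr1 ?ltW.
apply: (@continuous_comp R R R (fun t => `|t|) (fun a : R => a `^ p)).
  exact: norm_continuous.
apply/differentiable_continuous/derivable1_diffP/derivable_powR.
by rewrite in_itv /= andbT normr_gt0.
Qed.

Lemma strong_limit_values_norm_powR (p : R) : 0 < p ->
  strong_limit_values mu_ mu (fun j x => `|phi j x| `^ p)
                             (fun x => `|f x| `^ p).
Proof.
move=> p0; apply: (strong_limit_values_comp1 (fun s => `|s| `^ p)).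
- exact: continuous_norm_powR.
- by apply: (measurableT_comp (measurable_powR p)) => //; exact: normr_measurable.
(* Clipping [b] at 0 makes [M] the [p]-th power of its own [p]-th root, even for negative [b]. *)
- move=> a b; pose M := Num.max b 0; exists (M `^ p^-1) => s /andP[_ sb].
  rewrite leNgt; apply/negP => Ms.
  have := gt0_ltr_powR p0; move=> /(_ (M `^ p^-1) `|s|).
  rewrite !nnegrE powR_ge0 normr_ge0 => /(_ isT isT Ms).
  have M0 : 0 <= M by rewrite le_max lexx orbT.
  rewrite -powRrM mulVf ?gt_eqF// powRr1// => /lt_trans/(_ sb).
  by rewrite ltNge le_max lexx.
Qed.

(** As [g] is finite, the sets where [|g|] exceeds [n] decrease to the empty set, so one of them has
    small [mu]-measure; regularity turns this into an open neighborhood of small [mu_ j]-measure. *)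
Lemma regular_cvg_tail (g : K -> R) (e : R) : regular_cvg mu_ mu ->
  mu_measurable_fun mu (msupp mu) g -> 0 < e ->
  exists (N : R) (U : set K) (j0 : nat), [/\ open U,
    [set x | msupp mu x /\ N < `|g x|] `<=` U &
    forall j, (j0 <= j)%N -> (mu_ j U <= e%:E)%E].
Proof.
move=> reg; have mS := measurable_msupp mu.
move=> /(mu_measurable_funP _ _ _ mS)[N [mN N0 mg]] e0.
have mD : measurable ((msupp mu : set BK) `\` N) by exact: measurableD.
pose E n : set BK := [set x | ((msupp mu : set BK) `\` N) x /\ n%:R < `|g x|].
have mE n : measurable (E n).
  by apply: measurable_superlevel => //; exact: measurableT_comp.
have E0 : \bigcap_n E n = set0.
  rewrite -subset0 => x Ex; have [_] := Ex (Num.truncn `|g x|).+1 I.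
  by rewrite ltNge (ltW (truncnS_gt _)).
have [n En] : exists n, (mu (E n) < (e / 2)%:E)%E.
  apply: contrapT => /forallNP big.
  have := nonincreasing_cvg_mu (mu := mu) (F := E); rewrite E0 measure0.
  have homoE : nonincreasing_seq E.
    move=> n k nk; apply/subsetPset => x [Dx kx]; split=> //.
    by apply: le_lt_trans kx; rewrite ler_nat.
  have fin0 : (mu (E 0%N) < +oo)%E by rewrite ltey_eq fin_num_measure.
  move=> /(_ fin0 mE measurable0 homoE) cvgE.
  have : ((e / 2)%:E <= 0)%E.
    apply: (cvge_ge _ cvgE); apply: nearW => n /=.
    by rewrite leNgt; apply/negP; exact: big.
  by rewrite lee_fin; lra.
have e20 : 0 < e / 2 by rewrite divr_gt0.
(* [E n] and its union with [N] are the Borel kernel and hull that regularity requires for the tail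
   set [A]. *)
have EN0 : mu ((E n `|` N) `\` E n) = 0%E.
  apply: (subset_measure0 _ mN _ N0); last by move=> x [[|]].
  by apply: measurableD => //; exact: measurableU.
pose A := [set x | msupp mu x /\ n%:R < `|g x|].
have EA : E n `<=` A by move=> x [[]].
have AEN : A `<=` E n `|` N.
  by move=> x [Kx gx]; have [Nx|Nx] := pselect (N x); [right|left].
have AK : A `<=` msupp mu by move=> x [].
have [U [oU AU [j0 leU]]] :=
  reg A _ _ (mE n) (measurableU _ _ (mE n) mN) EA AEN EN0 AK _ e20.
exists n%:R, U, j0; split=> // j jj0; apply: (le_trans (ltW (leU j jj0))).
by rewrite [in leRHS](splitr e) EFinD; apply: leeD => //; exact: ltW.
Qed.

Lemma regular_strong_limit_values_comp (F : R * R -> R) psi g :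
  regular_cvg mu_ mu -> continuous F ->
  (forall (D : set BK) u v, measurable_fun D u -> measurable_fun D v ->
     measurable_fun D (fun x => F (u x, v x))) ->
  (forall j, measurable_fun (msupp (mu_ j) : set BK) (psi j)) ->
  strong_limit_values mu_ mu psi g ->
  strong_limit_values mu_ mu (fun j x => F (phi j x, psi j x))
                             (fun x => F (f x, g x)).
Proof.
move=> reg cF mF mpsi lpsi; apply: strong_limit_values_comp => // a b e e0.
have e20 : 0 < e / 2 by rewrite divr_gt0.
have [N1 [U1 [j1 [oU1 fU1 leU1]]]] := regular_cvg_tail _ _ reg lphi.1 e20.
have [N2 [U2 [j2 [oU2 gU2 leU2]]]] := regular_cvg_tail _ _ reg lpsi.1 e20.
exists (Num.max N1 N2), (U1 `|` U2), (maxn j1 j2); split; first exact: openU.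
  by move=> x [Kx _]; rewrite !gt_max => -[/andP[? _]|/andP[_ ?]];
    [left; exact: fU1|right; exact: gU2].
move=> j; rewrite geq_max => /andP[jj1 jj2].
apply: (le_trans (measureU2 (mu_ j) _ _)); try exact: open_borel.
by rewrite (splitr e) EFinD; apply: leeD; [exact: leU1|exact: leU2].
Qed.

End strong_limit_operations.

(** * Uniqueness, multiples, powers, sums and products of strong limit values *)

Theorem theorem3p3 (R : realType) (K : pseudoPMetricType R)
  (Kcompact : compact [set: K]) (Khaus : hausdorff_space K)
  (mu_ : nat -> {finite_measure set borel K -> \bar R})
  (mu : {finite_measure set borel K -> \bar R})
  (hw : weak_star_cvg mu_ mu)
  (phi : nat -> K -> R) (phis : K -> R)
  (phi_borel : forall j, measurable_fun (msupp (mu_ j) : set (borel K)) (phi j))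
  (hphi : strong_limit_values mu_ mu phi phis) :
  [/\ (forall f : K -> R, strong_limit_values mu_ mu phi f ->
         {ae mu, forall x : borel K, msupp mu x -> f x = phis x}),
      (forall c : R, strong_limit_values mu_ mu (fun j x => c * phi j x)
                       (fun x => c * phis x)),
      (forall p : R, 0 < p -> strong_limit_values mu_ mu
                       (fun j x => `|phi j x| `^ p) (fun x => `|phis x| `^ p)) &
      (regular_cvg mu_ mu ->
       forall (psi : nat -> K -> R) (psis : K -> R),
         (forall j, measurable_fun (msupp (mu_ j) : set (borel K)) (psi j)) ->
         in_AM mu_ mu psi ->
         strong_limit_values mu_ mu psi psis ->
         strong_limit_values mu_ mu (fun j x => phi j x + psi j x)
                                    (fun x => phis x + psis x) /\
         strong_limit_values mu_ mu (fun j x => phi j x * psi j x)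
                                    (fun x => phis x * psis x))].
Proof.
split.
- move=> f hf; exact: (strong_limit_values_ae_unique mu_ mu hw Kcompact phi).
- by move=> c; exact: strong_limit_values_scale.
- by move=> p p0; exact: strong_limit_values_norm_powR.
- move=> reg psi psis psi_borel _ hpsi; split.
  + apply: (regular_strong_limit_values_comp mu_ mu phi phis phi_borel hphi
      (fun p => p.1 + p.2)) => //.
    * by move=> p; apply: cvgD; [exact: cvg_fst|exact: cvg_snd].
    * by move=> D u v; exact: measurable_funD.
  + apply: (regular_strong_limit_values_comp mu_ mu phi phis phi_borel hphi
      (fun p => p.1 * p.2)) => //.
    * by move=> p; apply: cvgM; [exact: cvg_fst|exact: cvg_snd].
    * by move=> D u v; exact: measurable_funM.
Qed.
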